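(* $$\big\|\mathrm{Cov}(\hat{\mathcal{I}}_1(\theta))\big\|_F\le\frac1N\,\Big\|\frac{\partial h_L}{\partial\theta}\Big\|_F^4\,\big\|\mathcal{K}(t)-\mathcal{I}(h_L)\otimes\mathcal{I}(h_L)\big\|_F.$$
   Context: Setup. Fix an input $x\in\mathbb{R}^{n_0}$ and integers $L\ge1$, $n_1,\dots,n_L\ge1$. Network. The parameters are $\theta=(W_0,\dots,W_{L-1})$, with $W_l\in\mathbb{R}^{n_{l+1}\times(n_l+1)}$, viewed as a vector in $\mathbb{R}^{\dim\theta}$. Let $\sigma$ be differentiable and applied entrywise. Set $h_0=x$ and $\bar h_l=(h_l^\top,1)^\top$. For $1\le l\le L-1$ let $h_l=\sigma(W_{l-1}\bar h_{l-1})$, and let $h_L=W_{L-1}\bar h_{L-1}\in\mathbb{R}^{n_L}$. Exponential family. The model is $p(y\mid x,\theta)=\exp(t(y)^\top h_L-F(h_L))$ with respect to a base measure $\nu$, where $t(y)\in\mathbb{R}^{n_L}$ and $F(h)=\log\int\exp(t(y)^\top h)\,d\nu(y)$. Assume $h_L$ lies in the interior of the natural parameter space. Write $\eta=\nabla F(h_L)=\mathbb{E}[t(y)]$ and $\mathcal{I}(h_L)=\nabla^2F(h_L)=\mathrm{Cov}(t(y))$, with $y\sim p(y\mid x,\theta)$. Estimator. Let $\ell=\log p(y\mid x,\theta)$. With $N$ i.i.d. samples $y_i\sim p(y\mid x,\theta)$ and $\ell_i=\log p(y_i\mid x,\theta)$, let $\hat{\mathcal{I}}_1(\theta)=\frac1N\sum_i\frac{\partial\ell_i}{\partial\theta}\frac{\partial\ell_i}{\partial\theta^\top}$.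 Notation. $\mathrm{Cov}(\hat{\mathcal{I}}_1(\theta))$ is the 4-tensor with entries $\mathrm{Cov}(\hat{\mathcal{I}}_1^{ij},\hat{\mathcal{I}}_1^{kl})$. $\mathcal{K}_{abcd}(t)=\mathbb{E}[(t_a-\eta_a)(t_b-\eta_b)(t_c-\eta_c)(t_d-\eta_d)]$. $(\mathcal{I}(h_L)\otimes\mathcal{I}(h_L))_{abcd}=\mathcal{I}_{ab}(h_L)\mathcal{I}_{cd}(h_L)$. $\frac{\partial h_L}{\partial\theta}$ is the $n_L\times\dim\theta$ Jacobian. $\|\cdot\|_F$ is the square root of the sum of squared entries of a tensor. *)

(* Defs.v *)
From HB Require Import structures.
From mathcomp Require Import all_boot all_order all_algebra.
From mathcomp Require Import all_classical all_reals all_analysis.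
Set Implicit Arguments. Unset Strict Implicit. Unset Printing Implicit Defensive.
Import Order.TTheory GRing.Theory Num.Theory.
Import numFieldNormedType.Exports.
Local Open Scope classical_set_scope.
Local Open Scope ring_scope.

(* Network.  Widths n : nat -> nat (n 0 = n_0 is the input dimension),  *)
(* depth L.  Layer l < L has weight matrix W_l of size                 *)
(* n_{l+1} x (n_l + 1) (the last column multiplies the bias entry 1).   *)
(* The parameter vector theta is indexed by the finite type pidx L n  *)
(* of triples (l, i, j), l < L, i < n_{l+1}, j < n_l + 1;               *)
(* dim theta = #|pidx L n| = sum_l n_{l+1} (n_l + 1).                  *)
Definition pidx (L : nat) (n : nat -> nat) : finType :=
  {l : 'I_L & ('I_(n l.+1) * 'I_(n l + 1))%type}.

(* the weight matrix W_l read off theta (junk 0 for l >= L, never used) *)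
Definition Wmat {R : realType} (L : nat) (n : nat -> nat)
    (theta : pidx L n -> R) (l : nat) : 'M[R]_(n l.+1, n l + 1) :=
  \matrix_(i < n l.+1, j < n l + 1)
    match @idP (l < L)%N with
    | ReflectT Hl =>
        theta (@Tagged 'I_L (Ordinal Hl)
                 (fun k : 'I_L => ('I_(n k.+1) * 'I_(n k + 1))%type) ((i : 'I_(n l.+1)), (j : 'I_(n l + 1))))
    | ReflectF _ => 0
    end.

Fixpoint hlayer {R : realType} (L : nat) (n : nat -> nat) (x : 'cV[R]_(n 0))
    (sigma : R -> R) (theta : pidx L n -> R) (l : nat) : 'cV[R]_(n l) :=
  match l as l0 return 'cV[R]_(n l0) with
  | 0 => x
  | k.+1 =>
      let z := Wmat theta k *m col_mx (hlayer x sigma theta k) (const_mx 1) in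
      if (k.+1 < L)%N then map_mx sigma z else z
  end.

Definition hL {R : realType} (L : nat) (n : nat -> nat) (x : 'cV[R]_(n 0))
    (sigma : R -> R) (theta : pidx L n -> R) : 'cV[R]_(n L) :=
  hlayer x sigma theta L.

Definition perturb {R : realType} (L : nat) (n : nat -> nat)
    (theta : pidx L n -> R) (p : pidx L n) (s : R) : pidx L n -> R :=
  fun q => if q == p then theta q + s else theta q.

Definition pderiv {R : realType} (L : nat) (n : nat -> nat)
    (f : (pidx L n -> R) -> R) (theta : pidx L n -> R) (p : pidx L n) : R :=
  derive1 (fun s => f (perturb theta p s)) 0.

Definition jacL {R : realType} (L : nat) (n : nat -> nat) (x : 'cV[R]_(n 0))
    (sigma : R -> R) (theta : pidx L n -> R) (a : 'I_(n L)) (p : pidx L n) : R :=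
  pderiv (fun th => hL x sigma th a 0) theta p.

Definition dotv {R : realType} (m : nat) (u v : 'cV[R]_m) : R :=
  \sum_(a < m) u a 0 * v a 0.

Definition logpart {R : realType} {dY : measure_display} {Y : measurableType dY}
    (nu : {measure set Y -> \bar R}) (m : nat) (t : Y -> 'cV[R]_m)
    (h : 'cV[R]_m) : R :=
  ln (fine (\int[nu]_y (expR (dotv (t y) h))%:E)%E).

Definition natparam {R : realType} {dY : measure_display} {Y : measurableType dY}
    (nu : {measure set Y -> \bar R}) (m : nat) (t : Y -> 'cV[R]_m) :
    set 'cV[R]_m :=
  [set h | (\int[nu]_y (expR (dotv (t y) h))%:E < +oo)%E].

Definition efdens {R : realType} {dY : measure_display} {Y : measurableType dY}
    (nu : {measure set Y -> \bar R}) (m : nat) (t : Y -> 'cV[R]_m)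
    (h : 'cV[R]_m) (y : Y) : R :=
  expR (dotv (t y) h - logpart nu t h).

Definition efexp {R : realType} {dY : measure_display} {Y : measurableType dY}
    (nu : {measure set Y -> \bar R}) (m : nat) (t : Y -> 'cV[R]_m)
    (h : 'cV[R]_m) (f : Y -> R) : R :=
  fine (\int[nu]_y (f y * efdens nu t h y)%:E)%E.

Definition efmean {R : realType} {dY : measure_display} {Y : measurableType dY}
    (nu : {measure set Y -> \bar R}) (m : nat) (t : Y -> 'cV[R]_m)
    (h : 'cV[R]_m) (a : 'I_m) : R :=
  efexp nu t h (fun y => t y a 0).

Definition effisher {R : realType} {dY : measure_display} {Y : measurableType dY}
    (nu : {measure set Y -> \bar R}) (m : nat) (t : Y -> 'cV[R]_m)
    (h : 'cV[R]_m) (a b : 'I_m) : R :=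
  efexp nu t h (fun y => (t y a 0 - efmean nu t h a) * (t y b 0 - efmean nu t h b)).

Definition efK {R : realType} {dY : measure_display} {Y : measurableType dY}
    (nu : {measure set Y -> \bar R}) (m : nat) (t : Y -> 'cV[R]_m)
    (h : 'cV[R]_m) (a b c d : 'I_m) : R :=
  efexp nu t h (fun y => (t y a 0 - efmean nu t h a) * (t y b 0 - efmean nu t h b)
                       * (t y c 0 - efmean nu t h c) * (t y d 0 - efmean nu t h d)).

Definition loglik {R : realType} (L : nat) (n : nat -> nat) (x : 'cV[R]_(n 0))
    (sigma : R -> R) {dY : measure_display} {Y : measurableType dY}
    (nu : {measure set Y -> \bar R}) (t : Y -> 'cV[R]_(n L))
    (y : Y) (theta : pidx L n -> R) : R :=
  ln (efdens nu t (hL x sigma theta) y).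

Definition score {R : realType} (L : nat) (n : nat -> nat) (x : 'cV[R]_(n 0))
    (sigma : R -> R) {dY : measure_display} {Y : measurableType dY}
    (nu : {measure set Y -> \bar R}) (t : Y -> 'cV[R]_(n L))
    (theta : pidx L n -> R) (p : pidx L n) (y : Y) : R :=
  pderiv (loglik x sigma nu t y) theta p.

Definition Ihat1 {R : realType} (L : nat) (n : nat -> nat) (x : 'cV[R]_(n 0))
    (sigma : R -> R) {dY : measure_display} {Y : measurableType dY}
    (nu : {measure set Y -> \bar R}) (t : Y -> 'cV[R]_(n L))
    (theta : pidx L n -> R) (N : nat) {Omega : Type} (Ys : 'I_N -> Omega -> Y)
    (p q : pidx L n) (w : Omega) : R :=
  N%:R^-1 * \sum_(i < N) score x sigma nu t theta p (Ys i w)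
                         * score x sigma nu t theta q (Ys i w).

Definition mutually_independent {R : realType} {dO : measure_display}
    {Omega : measurableType dO} (P : probability Omega R)
    {dY : measure_display} {Y : measurableType dY} (N : nat)
    (Ys : 'I_N -> Omega -> Y) : Prop :=
  forall A : 'I_N -> set Y, (forall i, measurable (A i)) ->
    P (\bigcap_i (Ys i @^-1` A i)) = (\prod_(i < N) P (Ys i @^-1` A i))%E.

(* Main.v *)
Require Import Defs.
From HB Require Import structures.
From mathcomp Require Import all_boot all_order all_algebra.
From mathcomp Require Import all_classical all_reals all_analysis.
From mathcomp Require Import ring lra measurable_realfun.
Set Implicit Arguments. Unset Strict Implicit. Unset Printing Implicit Defensive.
Import Order.TTheory GRing.Theory Num.Theory.
Import numFieldNormedType.Exports.
Local Open Scope classical_set_scope.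
Local Open Scope ring_scope.

(** The score is linear in the centred sufficient statistic:
    [d l / d theta_p = sum_a J_ap (t_a - eta_a)], which requires differentiating
    the log-partition function along the curve [s |-> h_L (theta + s e_p)].
    As [sigma] is merely differentiable this curve need not be C^1, so instead of
    differentiating under the integral sign one integrates the second-order bound
    [|e^u - 1 - u| <= u^2 e^|u|]: near an interior point of the natural parameter
    space [e^(d |t|_1) e^(t . h)] is integrable, being at most the sum over signs of
    [e^(t . (h +- d))].  The same envelope makes every polynomial in [t]
    integrable.  Independence of the samples then reduces the covariance of the
    empirical mean to [1/N] times that of one summand, which is the contraction of
    [K - I (x) I] with four copies of [J], and Cauchy-Schwarz concludes. *)

(** * Contraction of a 4-tensor *)

(** Lagrange's identity: twice the gap between the two sides is the sum of the squared minors
    [u i * v j - u j * v i]. *)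
Lemma sum_cauchy_schwarz (R : realFieldType) (I : finType) (u v : I -> R) :
  (\sum_i u i * v i) ^+ 2 <= (\sum_i u i ^+ 2) * (\sum_i v i ^+ 2).
Proof.
rewrite -subr_ge0 -(pmulrn_lge0 _ (ltn0Sn 1)).
have -> : ((\sum_i u i ^+ 2) * (\sum_i v i ^+ 2) - (\sum_i u i * v i) ^+ 2) *+ 2
    = \sum_i \sum_j (u i * v j - u j * v i) ^+ 2.
  have -> : \sum_i \sum_j (u i * v j - u j * v i) ^+ 2 =
      \sum_i \sum_j (u i ^+ 2 * v j ^+ 2) + \sum_i \sum_j (v i ^+ 2 * u j ^+ 2)
      - (\sum_i \sum_j ((u i * v i) * (u j * v j))) *+ 2.
    rewrite -sumrMnl -big_split/= -sumrB; apply: eq_bigr => i _.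
    rewrite -sumrMnl -big_split/= -sumrB; apply: eq_bigr => j _; ring.
  rewrite -!big_distrlr/=; ring.
by apply: sumr_ge0 => i _; apply: sumr_ge0 => j _; exact: sqr_ge0.
Qed.

(** Flattening the four indices into one lets Cauchy-Schwarz for a single sum act on 4-tensors. *)
Lemma sum4_pairs (R : nmodType) (I : finType) (F : I -> I -> I -> I -> R) :
  \sum_a \sum_b \sum_c \sum_d F a b c d
  = \sum_(u : (I * I) * (I * I)) F u.1.1 u.1.2 u.2.1 u.2.2.
Proof.
rewrite pair_bigA/= -(pair_bigA _ (fun ab cd : I * I =>
  F ab.1 ab.2 cd.1 cd.2))/=.
by apply: eq_bigr => ab _; rewrite pair_bigA.
Qed.

(** For fixed [p, q, r, s], Cauchy-Schwarz over [(a, b, c, d)] separates [M] from the four factors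
    of [J]. The squared products of [J] sum to a product of squared column norms, and summing these
    over [p, q, r, s] gives the fourth power. *)
Lemma sqr_tensor_contraction_le (R : realFieldType) (I K : finType)
    (J : I -> K -> R) (M : I -> I -> I -> I -> R) :
  \sum_p \sum_q \sum_r \sum_s
    (\sum_a \sum_b \sum_c \sum_d
       J a p * J b q * J c r * J d s * M a b c d) ^+ 2
  <= (\sum_a \sum_p J a p ^+ 2) ^+ 4
     * \sum_a \sum_b \sum_c \sum_d M a b c d ^+ 2.
Proof.
pose sq p := \sum_a J a p ^+ 2.
have bound p q r s :
    (\sum_a \sum_b \sum_c \sum_d J a p * J b q * J c r * J d s * M a b c d) ^+ 2
    <= sq p * sq q * (sq r * sq s)
       * \sum_a \sum_b \sum_c \sum_d M a b c d ^+ 2.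
  rewrite !sum4_pairs; apply: le_trans (sum_cauchy_schwarz _ _) _.
  rewrite -(sum4_pairs (fun a b c d => (J a p * J b q * J c r * J d s) ^+ 2)).
  (* What remains is an equality: the sum of squared products factors into the four column norms. *)
  rewrite le_eqVlt; apply/orP; left; apply/eqP; congr (_ * _).
  rewrite /sq [in RHS]big_distrlr/= [in RHS]mulrC big_distrr/=.
  apply: eq_bigr => a _; rewrite mulrC big_distrl/=.
  apply: eq_bigr => b _; rewrite big_distrlr/= big_distrr/=.
  apply: eq_bigr => c _; rewrite big_distrr/=.
  by apply: eq_bigr => d _; ring.
have -> : (\sum_a \sum_p J a p ^+ 2) = \sum_p sq p by rewrite exchange_big.
have prod4 (f : K -> R) (C : R) : \sum_p \sum_q \sum_r \sum_s
    (f p * f q * (f r * f s) * C) = (\sum_p f p) ^+ 4 * C.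
  transitivity (\sum_p f p * (\sum_q f q * (\sum_r f r * (\sum_s f s * C)))).
    apply: eq_bigr => p _; rewrite big_distrr/=; apply: eq_bigr => q _.
    rewrite mulrA big_distrr/=; apply: eq_bigr => r _.
    by rewrite mulrA big_distrr/=; apply: eq_bigr => s _; ring.
  by rewrite -!big_distrl/=; ring.
rewrite -prod4.
by do 4![apply: ler_sum => ? _]; exact: bound.
Qed.

(** * Exponential families *)

(** Everything comes from [1 + u <= expR u] at [u] and at [- u]. For [0 <= u] it gives e^u - 1 - u
    <= u (e^u - 1) <= u^2 e^u; for [u < 0] it gives e^u - 1 - u <= u e^u - u <= u^2. *)
Lemma expR_remainder_bound (R : realType) (u : R) :
  `|expR u - 1 - u| <= u ^+ 2 * expR `|u|.
Proof.
have e1 := expR_ge1Dx u.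
have e2 := expR_ge1Dx (- u).
have up := expR_gt0 u.
have uN : expR u * expR (- u) = 1 by rewrite expRxMexpNx_1.
rewrite ger0_norm; last by lra.
have upper : expR u - 1 <= u * expR u.
  have := ler_wpM2l (ltW up) e2; rewrite uN; lra.
have [u0|u0] := leP 0 u.
  rewrite ger0_norm// expr2 -mulrA.
  have := ler_wpM2l u0 upper; lra.
rewrite ltr0_norm//.
have e3 : 1 <= expR (- u) by rewrite -(expR0 R) ler_expR; lra.
have u2 : 0 <= u ^+ 2 := sqr_ge0 u.
have := ler_wpM2l u2 e3.
have := ler_wnM2l (ltW u0) e1.
by rewrite mulr1; lra.
Qed.

(** The right side is the expanded product over [a] of e^(d x_a) + e^(- d x_a), and each such factor
    dominates e^(d |x_a|). *)
Lemma expR_sum_norm_le (R : realType) (m : nat) (d : R) (x : 'I_m -> R) :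
  expR (d * \sum_a `|x a|) <=
  \sum_(f : {ffun 'I_m -> bool}) expR (\sum_a x a * ((-1) ^+ f a * d)).
Proof.
have -> : \sum_(f : {ffun 'I_m -> bool}) expR (\sum_a x a * ((-1) ^+ f a * d)) =
    \prod_a \sum_(b : bool) expR (x a * ((-1) ^+ b * d)).
  by rewrite bigA_distr_bigA; apply: eq_bigr => f _; rewrite expR_sum.
rewrite mulr_sumr expR_sum; apply: ler_prod => a _.
rewrite expR_ge0/= big_bool/= expr0 expr1 mulN1r mul1r mulrN.
have [x0|x0] := leP 0 (x a).
  by rewrite ger0_norm// mulrC lerDr expR_ge0.
by rewrite ltr0_norm// mulrN mulrC lerDl expR_ge0.
Qed.

Lemma poly_le_expR (R : realType) (d : R) (k : nat) : 0 < d ->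
  exists2 C, 0 <= C & forall x, 0 <= x -> (1 + x) ^+ k <= C * expR (d * x).
Proof.
(* At rate [c] one has 1 + x <= (1 + 1/c) e^(c x), and the [k]-th power needs only the rate
   [k * c <= d]. Dividing by [k.+1] also covers [k = 0]. *)
move=> d0; pose c := d / k.+1%:R.
have c0 : 0 < c by rewrite divr_gt0.
exists ((1 + c^-1) ^+ k) => [|x x0].
  by rewrite exprn_ge0// addr_ge0// invr_ge0 ltW.
apply: (@le_trans _ _ (((1 + c^-1) * expR (c * x)) ^+ k)).
  have cx0 : 0 <= c * x by rewrite mulr_ge0// ltW.
  rewrite lerXn2r ?nnegrE ?addr_ge0 ?mulr_ge0 ?expR_ge0//.
    by rewrite addr_ge0// invr_ge0 ltW.
  have e1 := expR_ge1Dx (c * x).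
  rewrite mulrDl mul1r lerD//; first by lra.
  by rewrite ler_pdivlMl//; lra.
rewrite exprMn; apply: ler_wpM2l.
  by rewrite exprn_ge0// addr_ge0// invr_ge0 ltW.
rewrite -expRM_natl ler_expR mulrA; apply: ler_wpM2r => //.
rewrite /c mulrCA ger_pMr// ler_pdivrMr// mul1r ler_nat; exact: leqnSn.
Qed.

Lemma Rintegral_sum (R : realType) (d : measure_display) (T : measurableType d)
    (mu : {measure set T -> \bar R}) (I : Type) (s : seq I) (f : I -> T -> R) :
  (forall i, mu.-integrable setT (EFin \o f i)) ->
  \int[mu]_x (\sum_(i <- s) f i x) = \sum_(i <- s) \int[mu]_x f i x.
Proof.
move=> fint; rewrite /Rintegral; under eq_integral do rewrite -sumEFin.
rewrite (integral_sum measurableT fint) sum_fine//.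
by move=> i _; apply: integrable_fin_num => //; exact: fint.
Qed.

Lemma is_derive_sum_fun (R : realType) (m : nat) (f : 'I_m -> R -> R)
    (df : 'I_m -> R) (x : R) :
  (forall i, is_derive x 1 (f i) (df i)) ->
  is_derive x 1 (fun s => \sum_i f i s) (\sum_i df i).
Proof. by move=> fd; rewrite -fct_sumE; exact: is_derive_sum. Qed.

(** The difference quotient of [f] at 0 is dominated by that of [q], so a quadratic bound on a
    remainder yields its derivative without any regularity of [f] elsewhere. *)
Lemma is_derive0_squeeze (R : realType) (f q : R -> R) :
  f 0 = 0 -> q 0 = 0 -> is_derive (0 : R) 1 q 0 ->
  (\forall s \near (0 : R), `|f s| <= q s) -> is_derive (0 : R) 1 f 0.
Proof.
move=> f0 q0 [qd qD] fq.
have qcvg : s^-1 *: ((q \o shift 0) (s *: 1) - q 0) @[s --> 0^'] --> (0 : R).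
  by rewrite -[X in _ --> X]qD; exact: qd.
suff fcvg : s^-1 *: ((f \o shift 0) (s *: 1) - f 0) @[s --> 0^'] --> (0 : R).
  by apply: DeriveDef; [apply: cvgP fcvg|apply: cvg_lim fcvg].
apply/cvgr0Pnorm_le => e e0.
have fq' := @nbhs_dnbhs _ _ _ fq.
near=> s; apply: (@le_trans _ _ `|s^-1 *: ((q \o shift 0) (s *: 1) - q 0)|).
  rewrite /= [s *: 1]mulr1 !addr0 f0 q0 !subr0 !normrM.
  apply: ler_wpM2l => //; apply: le_trans (ler_norm _).
  by near: s; exact: fq'.
by near: s; move/cvgr0Pnorm_le : qcvg; apply.
Unshelve. all: by end_near. Qed.

(** * Moments and partition function near an interior natural parameter *)

Section exponential_family.
Context {R : realType} {dY : measure_display} {Y : measurableType dY}.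
Variables (nu : {measure set Y -> \bar R}) (m : nat) (t : Y -> 'cV[R]_m).
Variable (h : 'cV[R]_m).
Hypothesis mt : forall a, measurable_fun setT (fun y => t y a 0).
Hypothesis hint : interior (natparam nu t) h.

Definition tnorm (y : Y) : R := \sum_a `|t y a 0|.

Definition unnorm_dens (g : 'cV[R]_m) (y : Y) : R := expR (dotv (t y) g).

Definition partition_function (g : 'cV[R]_m) : R := \int[nu]_y unnorm_dens g y.

Lemma tnorm_ge0 y : 0 <= tnorm y.
Proof. exact: sumr_ge0. Qed.

Lemma measurable_tnorm : measurable_fun setT tnorm.
Proof. by apply: measurable_sum => a; exact: measurableT_comp. Qed.

Lemma measurable_unnorm_dens g : measurable_fun setT (unnorm_dens g).
Proof.
apply: measurableT_comp => //; apply: measurable_sum => a.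
exact: measurable_funM.
Qed.

Lemma natparam_integrable g : natparam nu t g ->
  nu.-integrable setT (EFin \o unnorm_dens g).
Proof.
move=> ng; apply/integrableP; split.
  by apply/measurable_EFinP; exact: measurable_unnorm_dens.
rewrite (eq_integral (EFin \o unnorm_dens g))// => y _ /=.
by rewrite ger0_norm// expR_ge0.
Qed.

Lemma natparam_neighborhood :
  exists2 d : R, 0 < d & forall v : 'cV[R]_m, (forall a, `|v a 0| <= d) ->
    natparam nu t (h + v).
Proof.
have /nbhs_ballP[e /= e0 he] := hint.
(* Halving the radius fits the closed box [|v a 0| <= d] inside the open ball. *)
exists (e / 2); first by rewrite divr_gt0.
move=> v vd; apply: he; split=> // i j; rewrite !mxE ord1 /ball/= opprD addrA subrr.
by rewrite sub0r normrN (le_lt_trans (vd i))// ltr_pdivrMr// ltr_pMr// ltr1n.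
Qed.

Lemma envelope_integrable :
  exists2 d : R, 0 < d & nu.-integrable setT
    (EFin \o (fun y => expR (d * tnorm y) * unnorm_dens h y)).
Proof.
have [d d0 hd] := natparam_neighborhood.
exists d => //.
(* The [v f] are the vertices of the cube of half-side [d]; the envelope is at most the sum of the
   densities at [h + v f]. *)
pose v (f : {ffun 'I_m -> bool}) : 'cV[R]_m := \col_a ((-1) ^+ f a * d).
have iv : nu.-integrable setT (EFin \o (fun y =>
    \sum_(f : {ffun 'I_m -> bool}) unnorm_dens (h + v f) y)).
  rewrite (_ : EFin \o _ = fun y => (\sum_(f : {ffun 'I_m -> bool})
      (EFin \o unnorm_dens (h + v f)) y)%E); last first.
    by apply/funext => y /=; rewrite sumEFin.
  apply: integrable_sum => // f _; apply: natparam_integrable; apply: hd => a.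
  by rewrite mxE normrM normrX normrN1 expr1n mul1r ger0_norm// ltW.
apply: le_integrable iv => //.
  apply/measurable_EFinP; apply: measurable_funM.
    apply: measurableT_comp => //; apply: measurable_funM => //.
    exact: measurable_tnorm.
  exact: measurable_unnorm_dens.
move=> y _; rewrite lee_fin ger0_norm ?mulr_ge0 ?expR_ge0//.
rewrite ger0_norm ?sumr_ge0// => [|f _]; last exact: expR_ge0.
apply: le_trans (ler_wpM2r (expR_ge0 _) (expR_sum_norm_le _ _)) _.
rewrite mulr_suml; apply: ler_sum => f _.
rewrite /unnorm_dens -expRD ler_expR addrC -big_split/=.
by apply: ler_sum => a _; rewrite !mxE mulrDr.
Qed.

(** A class closed under sums and products, so that integrability of every moment reduces to a
    structural check. The base [1 + tnorm y] is at least 1, which allows exponents to be raised to a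
    common value. *)
Definition poly_bounded (f : Y -> R) : Prop :=
  measurable_fun setT f /\
  exists C k, 0 <= C /\ forall y, `|f y| <= C * (1 + tnorm y) ^+ k.

Lemma poly_bounded_cst c : poly_bounded (cst c).
Proof.
by split=> //; exists `|c|, 0; split=> // y; rewrite expr0 mulr1.
Qed.

Lemma poly_bounded_t a : poly_bounded (fun y => t y a 0).
Proof.
split=> //; exists 1, 1%N; split=> // y; rewrite mul1r expr1.
rewrite /tnorm (bigD1 a)//= addrCA lerDl addr_ge0//; exact: sumr_ge0.
Qed.

Lemma poly_boundedM f g : poly_bounded f -> poly_bounded g ->
  poly_bounded (fun y => f y * g y).
Proof.
move=> [mf [C [k [C0 fC]]]] [mg [D [l [D0 gD]]]]; split.
  exact: measurable_funM.
exists (C * D), (k + l)%N; split=> [|y]; first exact: mulr_ge0.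
by rewrite normrM exprD mulrACA ler_pM.
Qed.

Lemma poly_boundedD f g : poly_bounded f -> poly_bounded g ->
  poly_bounded (fun y => f y + g y).
Proof.
move=> [mf [C [k [C0 fC]]]] [mg [D [l [D0 gD]]]]; split.
  exact: measurable_funD.
have X1 y : 1 <= 1 + tnorm y by rewrite lerDl tnorm_ge0.
exists (C + D), (k + l)%N; split=> [|y]; first exact: addr_ge0.
apply: le_trans (ler_normD _ _) _; rewrite mulrDl lerD//.
  by apply: le_trans (fC y) _; rewrite ler_wpM2l// ler_weXn2l// leq_addr.
by apply: le_trans (gD y) _; rewrite ler_wpM2l// ler_weXn2l// leq_addl.
Qed.

Lemma poly_boundedB f g : poly_bounded f -> poly_bounded g ->
  poly_bounded (fun y => f y - g y).
Proof.
move=> pf pg; under eq_fun do rewrite -mulN1r.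
by apply: poly_boundedD => //; apply: poly_boundedM => //; exact: poly_bounded_cst.
Qed.

Lemma poly_bounded_sum (I : Type) (s : seq I) (f : I -> Y -> R) :
  (forall i, poly_bounded (f i)) -> poly_bounded (fun y => \sum_(i <- s) f i y).
Proof.
move=> pf; elim: s => [|i s IH].
  under eq_fun do rewrite big_nil; exact: poly_bounded_cst.
under eq_fun do rewrite big_cons; exact: poly_boundedD.
Qed.

Lemma poly_bounded_tnorm : poly_bounded tnorm.
Proof.
split; first exact: measurable_tnorm.
exists 1, 1%N; split=> // y.
by rewrite mul1r expr1 ger0_norm ?tnorm_ge0// lerDr.
Qed.

Lemma poly_bounded_envelope_integrable :
  exists2 d : R, 0 < d & forall f, poly_bounded f -> nu.-integrable setT
    (EFin \o (fun y => f y * expR (d * tnorm y) * unnorm_dens h y)).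
Proof.
have [d d0 id] := envelope_integrable.
(* Half of the exponential rate absorbs the polynomial; the other half is kept as envelope. *)
exists (d / 2) => [|f [mf [C [k [C0 fC]]]]]; first by rewrite divr_gt0.
have [D D0 hD] := poly_le_expR k (divr_gt0 d0 (ltr0n R 2)).
have := integrableZl measurableT (C * D) id.
apply: le_integrable => //.
  apply/measurable_EFinP; apply: measurable_funM; last exact: measurable_unnorm_dens.
  apply: measurable_funM => //; apply: measurableT_comp => //.
  by apply: measurable_funM => //; exact: measurable_tnorm.
move=> y _; rewrite lee_fin !normrM.
rewrite (ger0_norm C0) (ger0_norm D0) !(ger0_norm (expR_ge0 _)) !mulrA.
apply: ler_wpM2r; first exact: expR_ge0.
rewrite [in leRHS](splitr d) mulrDl expRD !mulrA; apply: ler_wpM2r.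
  exact: expR_ge0.
apply: le_trans (fC y) _; rewrite -mulrA ler_wpM2l//.
exact/hD/tnorm_ge0.
Qed.

Lemma poly_bounded_integrable f : poly_bounded f ->
  nu.-integrable setT (EFin \o (fun y => f y * unnorm_dens h y)).
Proof.
move=> pf; have [d d0 /(_ f pf)] := poly_bounded_envelope_integrable.
apply: le_integrable => //.
  apply/measurable_EFinP; apply: measurable_funM; last exact: measurable_unnorm_dens.
  by case: pf.
move=> y _; rewrite lee_fin !normrM !(ger0_norm (expR_ge0 _)).
apply: ler_wpM2r; first exact: expR_ge0.
apply: ler_peMr => //; rewrite -(expR0 R) ler_expR mulr_ge0 ?tnorm_ge0//.
exact: ltW.
Qed.

(** First-order Taylor expansion at [h] with a quadratic remainder, obtained by integrating
    [expR_remainder_bound] at u = t . v against the unnormalised density. *)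
Lemma partition_function_expansion :
  exists2 d : R, 0 < d & exists B : R, forall v : 'cV[R]_m,
    (forall a, `|v a 0| <= d) ->
    `|partition_function (h + v) - partition_function h
      - \sum_a v a 0 * \int[nu]_y (t y a 0 * unnorm_dens h y)|
    <= B * \sum_a v a 0 ^+ 2.
Proof.
have [d1 d10 hd1] := poly_bounded_envelope_integrable.
have [d2 d20 hd2] := natparam_neighborhood.
(* [d1] gives the integrable envelope, [d2] keeps [h + v] in the natural parameter space. *)
pose d := Num.min d1 d2.
have d0 : 0 < d by rewrite lt_min d10.
pose E y := tnorm y * tnorm y * expR (d1 * tnorm y) * unnorm_dens h y.
have iE : nu.-integrable setT (EFin \o E).
  apply: hd1; exact: poly_boundedM poly_bounded_tnorm poly_bounded_tnorm.
exists d => //; exists (\int[nu]_y E y) => v vd.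
have ih : nu.-integrable setT (EFin \o unnorm_dens h).
  exact/natparam_integrable/(interior_subset hint).
have ihv : nu.-integrable setT (EFin \o unnorm_dens (h + v)).
  apply/natparam_integrable/hd2 => a; apply: le_trans (vd a) _.
  by rewrite ge_min lexx orbT.
have it a : nu.-integrable setT (EFin \o (fun y => t y a 0 * unnorm_dens h y)).
  exact/poly_bounded_integrable/poly_bounded_t.
have itv a : nu.-integrable setT
    (EFin \o (fun y => v a 0 * (t y a 0 * unnorm_dens h y))).
  exact: (integrableZl measurableT (v a 0) (it a)).
have isum : nu.-integrable setT
    (EFin \o (fun y => \sum_a v a 0 * (t y a 0 * unnorm_dens h y))).
  rewrite (_ : EFin \o _ = fun y => (\sum_a
      (v a 0 * (t y a 0 * unnorm_dens h y))%:E)%E); last first.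
    by apply/funext => y /=; rewrite sumEFin.
  by apply: integrable_sum => // a _; exact: itv.
have idiff : nu.-integrable setT
    (EFin \o (fun y => unnorm_dens (h + v) y - unnorm_dens h y)).
  exact: (integrableB measurableT ihv ih).
have irem : nu.-integrable setT (EFin \o (fun y =>
    unnorm_dens (h + v) y - unnorm_dens h y
    - \sum_a v a 0 * (t y a 0 * unnorm_dens h y))).
  exact: (integrableB measurableT idiff isum).
have -> : \sum_a v a 0 * \int[nu]_y (t y a 0 * unnorm_dens h y) =
    \int[nu]_y \sum_a v a 0 * (t y a 0 * unnorm_dens h y).
  by rewrite Rintegral_sum//; apply: eq_bigr => a _; rewrite RintegralZl.
rewrite /partition_function -RintegralB// -RintegralB//.
apply: le_trans (le_normr_Rintegral _ _) _ => //.
rewrite mulrC -RintegralZl//; apply: le_Rintegral => //.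
- exact: integrable_norm.
- exact: (integrableZl measurableT _ iE).
move=> y _.
set u := dotv (t y) v.
have udot : unnorm_dens (h + v) y = unnorm_dens h y * expR u.
  rewrite /unnorm_dens -expRD /u /dotv -big_split/=.
  by congr expR; apply: eq_bigr => a _; rewrite !mxE mulrDr.
have -> : \sum_a v a 0 * (t y a 0 * unnorm_dens h y) = unnorm_dens h y * u.
  by rewrite /u /dotv mulr_sumr; apply: eq_bigr => a _; ring.
rewrite udot (_ : _ - _ = unnorm_dens h y * (expR u - 1 - u)); last by ring.
rewrite normrM ger0_norm ?expR_ge0// /E !mulrA [leRHS]mulrC.
apply: ler_wpM2l; first exact: expR_ge0.
(* Cauchy-Schwarz and |t|_2 <= |t|_1 bound [u ^+ 2] by |v|_2^2 |t|_1^2, while [|u|] is at most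
   [d1 * tnorm y]; the integral of [E] is therefore an admissible [B]. *)
apply: le_trans (expR_remainder_bound u) _; apply: ler_pM => //.
- exact: sqr_ge0.
- rewrite /u /dotv; apply: le_trans (sum_cauchy_schwarz _ _) _.
  rewrite mulrC -mulrA; apply: ler_wpM2l; first by apply: sumr_ge0 => a _; exact: sqr_ge0.
  rewrite /tnorm mulr_suml; apply: ler_sum => a _.
  rewrite -real_normK ?num_real// expr2; apply: ler_wpM2l => //.
  by rewrite (bigD1 a)//= lerDl; exact: sumr_ge0.
rewrite ler_expR /u /dotv /tnorm mulr_sumr.
apply: le_trans (ler_norm_sum _ _ _) _; apply: ler_sum => a _.
rewrite normrM mulrC; apply: ler_wpM2r => //; apply: le_trans (vd a) _.
by rewrite ge_min lexx.
Qed.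

(** * Normalised expectations and the derivative of the log-partition function *)

Section normalized.
Hypothesis Z0 : 0 < partition_function h.

(** Positivity of the partition function is what lets [expR] undo the [ln] inside [logpart]. *)
Lemma efdensE y : efdens nu t h y = (partition_function h)^-1 * unnorm_dens h y.
Proof.
rewrite /efdens expRB mulrC; congr (_^-1 * _).
exact: lnK.
Qed.

Lemma efdens_integrable f : poly_bounded f ->
  nu.-integrable setT (EFin \o (fun y => f y * efdens nu t h y)).
Proof.
move=> pf; under eq_fun do rewrite efdensE mulrCA.
exact: (integrableZl measurableT _ (poly_bounded_integrable pf)).
Qed.

Lemma efexp_sum (I : finType) (c : I -> R) (f : I -> Y -> R) :
  (forall i, poly_bounded (f i)) ->
  efexp nu t h (fun y => \sum_i c i * f i y) =
  \sum_i c i * efexp nu t h (f i).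
Proof.
move=> pf; rewrite /efexp.
transitivity (\int[nu]_y \sum_i (c i * (f i y * efdens nu t h y))).
  apply: eq_Rintegral => y _; rewrite mulr_suml.
  by apply: eq_bigr => i _; rewrite mulrA.
rewrite Rintegral_sum => [|i]; last first.
  exact: (integrableZl measurableT _ (efdens_integrable (pf i))).
by apply: eq_bigr => i _; rewrite RintegralZl//; exact: efdens_integrable.
Qed.

Lemma efmeanE a : efmean nu t h a =
  (partition_function h)^-1 * \int[nu]_y (t y a 0 * unnorm_dens h y).
Proof.
rewrite -RintegralZl//; last exact/poly_bounded_integrable/poly_bounded_t.
by apply: eq_Rintegral => y _; rewrite efdensE mulrCA.
Qed.

(** The curve [g] is only required to be differentiable at 0. The partition function along it is a
    constant plus a linear term in the displacement plus a remainder of zero derivative; composing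
    with [ln] divides the linear term by the partition function, which turns raw first moments into
    means. *)
Lemma is_derive_logpart (g : R -> 'cV[R]_m) (dg : 'I_m -> R) :
  g 0 = h -> (forall a, is_derive (0 : R) 1 (fun s => g s a 0) (dg a)) ->
  is_derive (0 : R) 1 (fun s => logpart nu t (g s))
    (\sum_a dg a * efmean nu t h a).
Proof.
move=> g0 gd; have [d d0 [B hB]] := partition_function_expansion.
pose M a := \int[nu]_y (t y a 0 * unnorm_dens h y).
pose v s a := g s a 0 - h a 0.
have v0 a : v 0 a = 0 by rewrite /v g0 subrr.
have vd a : is_derive (0 : R) 1 (v ^~ a) (dg a).
  by rewrite -[dg a]subr0; apply: is_deriveB.
pose rem s := partition_function (g s) - partition_function h - \sum_a v s a * M a.
(* Continuity at 0 brings the displacement into the box where the expansion is valid. *)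
have vsmall : \forall s \near (0 : R), forall a, `|v s a| <= d.
  apply: (@filter_forall R 'I_m (fun a s => `|v s a| <= d) (nbhs (0 : R))) => a.
  have vc : {for 0, continuous (v ^~ a)}.
    by apply/differentiable_continuous/derivable1_diffP; case: (vd a).
  move/cvgr_norm_le : vc; apply.
  by rewrite v0 normr0.
(* The remainder is at most [B] times a sum of squares of functions vanishing at 0, and such squares
   have derivative zero there. *)
have remd : is_derive (0 : R) 1 rem 0.
  apply: (@is_derive0_squeeze _ _ (fun s => B * \sum_a v s a * v s a)).
  - rewrite /rem g0 subrr big1 ?subr0// => a _; by rewrite v0 mul0r.
  - by rewrite big1 ?mulr0// => a _; rewrite v0 mul0r.
  - have vvd : is_derive (0 : R) 1 (fun s => \sum_a v s a * v s a)
        (\sum_a (v 0 a * dg a + v 0 a * dg a)).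
      by apply: is_derive_sum_fun => a; exact: (is_deriveM (vd a) (vd a)).
    apply: (is_derive_eq (is_deriveZ B vvd)).
    by rewrite big1 ?scaler0// => a _; rewrite v0 !mul0r addr0.
  near=> s; have vs : forall a, `|v s a| <= d by near: s.
  have -> : \sum_a v s a * v s a = \sum_a (g s - h) a 0 ^+ 2.
    by apply: eq_bigr => a _; rewrite !mxE expr2.
  have -> : rem s = partition_function (h + (g s - h)) - partition_function h
      - \sum_a (g s - h) a 0 * M a.
    rewrite [h + _]addrC subrK /rem; congr (_ - _).
    by apply: eq_bigr => a _; rewrite !mxE.
  by apply: hB => a; rewrite !mxE; exact: vs.
have Zd : is_derive (0 : R) 1 (fun s => partition_function (g s)) (\sum_a dg a * M a).
  rewrite (_ : (fun s => partition_function (g s)) =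
      (cst (partition_function h) + (fun s => \sum_a v s a * M a)) + rem); last first.
    by apply/funext => s; rewrite /rem !fctE /cst; ring.
  have sd : is_derive (0 : R) 1 (fun s => \sum_a v s a * M a) (\sum_a dg a * M a).
    apply: is_derive_sum_fun => a; under eq_fun do rewrite mulrC.
    by rewrite mulrC; exact: (is_deriveZ (M a) (vd a)).
  apply: (is_derive_eq (is_deriveD (is_deriveD (is_derive_cst _ _ _) sd) remd)).
  by rewrite add0r addr0.
rewrite (_ : \sum_a _ = (partition_function (g 0))^-1 * \sum_a dg a * M a); last first.
  by rewrite mulr_sumr g0; apply: eq_bigr => a _; rewrite efmeanE mulrCA.
by apply: is_derive1_comp => //; apply: is_derive1_ln; rewrite g0.
Unshelve. all: by end_near. Qed.

End normalized.

End exponential_family.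

(** * Derivatives of the network and the score *)

Lemma derivable_sum_fun (R : realType) (m : nat) (f : 'I_m -> R -> R) (x : R) :
  (forall i, derivable (f i) x 1) -> derivable (fun s => \sum_i f i s) x 1.
Proof.
by move=> fd; have [] := is_derive_sum_fun (fun i => derivableP (fd i)).
Qed.

Section network.
Context {R : realType} (L : nat) (n : nat -> nat).
Variables (x : 'cV[R]_(n 0)) (sigma : R -> R) (theta : pidx L n -> R).
Hypothesis dsigma : forall z : R, derivable sigma z 1.

Lemma derivable_Wmat_perturb p l i j (s : R) :
  derivable (fun s => Wmat (perturb theta p s) l i j) s 1.
Proof.
(* The proof of [l < L] occurs in the index fed to [theta], so the case analysis is done for an
   arbitrary [reflect] and an arbitrary branch. *)
have dmatch (Q : Prop) b (r : reflect Q b) (F : Q -> R -> R) :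
    (forall q, derivable (F q) s 1) ->
    derivable (fun s => match r with ReflectT q => F q s | ReflectF _ => 0 end) s 1.
  by case: r => [q|_] dF; [exact: dF|exact: derivable_cst].
under eq_fun do rewrite mxE.
apply: (dmatch _ _ _ (fun lL s => perturb theta p s _)) => lL.
rewrite /perturb; case: (_ == p); last exact: derivable_cst.
apply: (@derivableD _ _ _ (cst _) id); [exact: derivable_cst|exact: derivable_id].
Qed.

Lemma derivable_hlayer_perturb p l a (s : R) :
  derivable (fun s => hlayer x sigma (perturb theta p s) l a 0) s 1.
Proof.
elim: l a s => [|l IH] a s /=; first exact: derivable_cst.
have dz a' s' : derivable (fun s => (Wmat (perturb theta p s) l *m
    col_mx (hlayer x sigma (perturb theta p s) l) (const_mx 1)) a' 0) s' 1.
  under eq_fun do rewrite mxE.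
  pose F j s := Wmat (perturb theta p s) l a' j *
    col_mx (hlayer x sigma (perturb theta p s) l) (const_mx 1) j 0.
  apply: (@derivable_sum_fun _ _ F) => j.
  apply: (@derivableM _ _ (fun s => Wmat (perturb theta p s) l a' j)
    (fun s => col_mx (hlayer x sigma (perturb theta p s) l) (const_mx 1) j 0)).
    exact: derivable_Wmat_perturb.
  under eq_fun do rewrite mxE.
  by case: (fintype.split j) => k; [exact: IH|under eq_fun do rewrite mxE; exact: derivable_cst].
case: (l.+1 < L)%N; last exact: dz.
under eq_fun do rewrite mxE.
apply/derivable1_diffP.
apply: (@differentiable_comp _ _ _ _ _ sigma); apply/derivable1_diffP.
  exact: dz.
exact: dsigma.
Qed.

Lemma perturb0 (p : pidx L n) : perturb theta p 0 = theta.
Proof. by apply/funext => q; rewrite /perturb addr0 if_same. Qed.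

Lemma is_derive_hL a p :
  is_derive (0 : R) 1 (fun s => hL x sigma (perturb theta p s) a 0)
    (jacL x sigma theta a p).
Proof.
rewrite /jacL /pderiv derive1E.
exact/derivableP/derivable_hlayer_perturb.
Qed.

Lemma scoreE {dY : measure_display} {Y : measurableType dY}
    (nu : {measure set Y -> \bar R}) (t : Y -> 'cV[R]_(n L)) p y :
  (forall a, measurable_fun setT (fun y => t y a 0)) ->
  interior (natparam nu t) (hL x sigma theta) ->
  0 < partition_function nu t (hL x sigma theta) ->
  score x sigma nu t theta p y =
  \sum_a jacL x sigma theta a p * (t y a 0 - efmean nu t (hL x sigma theta) a).
Proof.
move=> mt hint Z0; rewrite /score /pderiv derive1E.
(* Since [ln] cancels [expR] everywhere, this splitting holds for all [s]; positivity of the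
   partition function matters only at [s = 0]. *)
rewrite (_ : (fun s => _) = (fun s => \sum_a t y a 0 * hL x sigma (perturb theta p s) a 0)
   - (fun s => logpart nu t (hL x sigma (perturb theta p s)))); last first.
  by apply/funext => s; rewrite /loglik /efdens expRK.
have d1 : is_derive (0 : R) 1
    (fun s => \sum_a t y a 0 * hL x sigma (perturb theta p s) a 0)
    (\sum_a t y a 0 * jacL x sigma theta a p).
  by apply: is_derive_sum_fun => a; exact: (is_deriveZ _ (is_derive_hL a p)).
have d2 := is_derive_logpart mt hint Z0
  (g := fun s => hL x sigma (perturb theta p s)) (congr1 _ (perturb0 p))
  (is_derive_hL ^~ p).
have [_ ->] := is_deriveB d1 d2.
by rewrite -sumrB; apply: eq_bigr => a _; ring.
Qed.

End network.

(** * Densities, independence and sample means *)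

Section density.
Local Open Scope ereal_scope.
Context {R : realType} {d : measure_display} {T : measurableType d}.
Variables (mu nu : {measure set T -> \bar R}) (w : T -> R).
Hypothesis mw : measurable_fun setT w.
Hypothesis w0 : forall y, (0 <= w y)%R.
Hypothesis muE : forall A, measurable A -> mu A = \int[nu]_(y in A) (w y)%:E.

Import HBNNSimple.

(** On each level set the identity is [muE]; linearity over the finite range does the rest. *)
Let nnsfun_density (h : {nnsfun T >-> R}) :
  \int[mu]_y (h y)%:E = \int[nu]_y ((h y)%:E * (w y)%:E).
Proof.
have mind r : measurable_fun setT (fun y => (r * \1_(h @^-1` [set r]) y)%:E).
  by apply/measurable_EFinP; exact: measurable_funM.
have mwE : measurable_fun setT (fun y => (w y)%:E) by exact/measurable_EFinP.
transitivity (\int[mu]_y \sum_(r \in range h) (r * \1_(h @^-1` [set r]) y)%:E).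
  by apply: eq_integral => y _; rewrite {1}(fimfunE h y) -fsumEFin.
transitivity (\int[nu]_y \sum_(r \in range h)
    ((r * \1_(h @^-1` [set r]) y)%:E * (w y)%:E)); last first.
  apply: eq_integral => y _.
  rewrite -ge0_mule_fsuml => [|r]; last exact: nnfun_muleindic_ge0.
  by rewrite fsumEFin// -(fimfunE h y).
rewrite !ge0_integral_fsum//.
- apply: eq_fsbigr => r /[!inE] -[y _ hr].
  have r0 : (0 <= r)%R by rewrite -hr.
  have mA : measurable (h @^-1` [set r]) by exact: measurable_funPTI.
  under eq_integral do rewrite EFinM.
  rewrite ge0_integralZl//; last exact/measurable_EFinP.
  rewrite integral_indic// setIT muE//.
  under [RHS]eq_integral do rewrite EFinM -muleA.
  rewrite ge0_integralZl//; last 2 first.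
  + by apply: emeasurable_funM => //; exact/measurable_EFinP.
  + by move=> z _; rewrite mule_ge0// lee_fin.
  congr (_ * _); rewrite integral_mkcond; apply: eq_integral => z _.
  by rewrite muleC epatch_indic.
- by move=> r; apply: emeasurable_funM.
- by move=> r y _; rewrite mule_ge0 ?lee_fin// -lee_fin nnfun_muleindic_ge0.
- by move=> r y _; exact: nnfun_muleindic_ge0.
Qed.

(** Monotone convergence on both sides along an increasing sequence of simple functions. *)
Lemma ge0_integral_density (f : T -> \bar R) :
  measurable_fun setT f -> (forall y, 0 <= f y) ->
  \int[mu]_y f y = \int[nu]_y (f y * (w y)%:E).
Proof.
move=> mf f0; pose h := nnsfun_approx measurableT mf.
have hf y : (h k y)%:E @[k --> \oo] --> f y by exact: cvg_nnsfun_approx.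
have h_nd y : {homo (fun k => h k y) : a b / (a <= b)%N >-> (a <= b)%R}.
  by move=> a b ab; exact/lefP/nd_nnsfun_approx.
transitivity (limn (fun k => \int[mu]_y (h k y)%:E)).
  rewrite -monotone_convergence//.
  - by apply: eq_integral => y _; apply/esym/cvg_lim => //; exact: hf.
  - by move=> k; exact/measurable_EFinP.
  - by move=> k y _; rewrite lee_fin.
  - by move=> y _ a b ab; rewrite lee_fin; exact: h_nd.
under eq_fun do rewrite nnsfun_density.
rewrite -monotone_convergence//.
- apply: eq_integral => y _; apply/cvg_lim => //.
  by apply: cvgeZr => //; exact: hf.
- by move=> k; apply: emeasurable_funM; exact/measurable_EFinP.
- by move=> k y _; rewrite mule_ge0// lee_fin.
- by move=> y _ a b ab; rewrite lee_wpmul2r ?lee_fin//; exact: h_nd.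
Qed.

Lemma integral_density (f : T -> R) : measurable_fun setT f ->
  nu.-integrable setT (fun y => (f y * w y)%:E) ->
  mu.-integrable setT (EFin \o f) /\
  \int[mu]_y (f y)%:E = \int[nu]_y (f y * w y)%:E.
Proof.
move=> mf /integrableP[mfw ifw].
have mfE : measurable_fun setT (EFin \o f) by exact/measurable_EFinP.
have imf : mu.-integrable setT (EFin \o f).
  apply/integrableP; split => //.
  rewrite ge0_integral_density//; last exact: measurableT_comp.
  apply: le_lt_trans ifw; apply: ge0_le_integral => //.
  - by move=> y _; rewrite mule_ge0// lee_fin.
  - by apply: emeasurable_funM; [exact: measurableT_comp|exact/measurable_EFinP].
  - exact: measurableT_comp.
  by move=> y _; rewrite /= normrM (ger0_norm (w0 y)).
split=> //.
rewrite integralE [RHS]integralE.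
rewrite !ge0_integral_density//; [|exact: measurable_funeneg|exact: measurable_funepos].
(* As [w] is nonnegative, multiplying by it commutes with taking positive and negative parts. *)
congr (_ - _); apply: eq_integral => y _.
- by rewrite !funeposE -EFin_max -EFinM maxr_pMl// mul0r -EFin_max.
- by rewrite !funenegE -!EFinN -EFin_max -EFinM maxr_pMl// mul0r mulNr -EFin_max.
Qed.

End density.

(** * Product rule for expectations of independent variables *)

Section independence.
Local Open Scope ereal_scope.
Context {R : realType} {dO d : measure_display} {Omega : measurableType dO}
  {T : measurableType d} (P : probability Omega R).
Variables (X X' : {mfun Omega >-> T}).
Hypothesis indep : forall A B, measurable A -> measurable B ->
  P (X @^-1` A `&` X' @^-1` B) = P (X @^-1` A) * P (X' @^-1` B).
Variables (f g : T -> R).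
Hypotheses (mf : measurable_fun setT f) (mg : measurable_fun setT g).
Hypotheses (intf : P.-integrable setT (EFin \o (f \o X)))
           (intg : P.-integrable setT (EFin \o (g \o X'))).

Let Z w := (X w, X' w).
Let mZ : measurable_fun setT Z.
Proof. by apply: measurable_fun_pair. Qed.
HB.instance Definition _ := isMeasurableFun.Build _ _ _ _ Z mZ.

Let m1 := distribution P X.
Let m2 := distribution P X'.
Let fg (u : T * T) := (f u.1 * g u.2)%:E.

Let mfg : measurable_fun setT fg.
Proof.
apply/measurable_EFinP; apply: measurable_funM.
- exact: measurableT_comp.
- exact: measurableT_comp.
Qed.

(** Independence is agreement of the two measures on rectangles, which determines the product
    measure. *)
Let distribution_pair C : measurable C -> (m1 \x m2) C = distribution P Z C.
Proof.
by move=> mC; apply: product_measure_unique.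
Qed.

Let im1 : m1.-integrable setT (EFin \o f).
Proof. by apply: integrable_pushforward => //; exact/measurable_EFinP. Qed.

Let im2 : m2.-integrable setT (EFin \o g).
Proof. by apply: integrable_pushforward => //; exact/measurable_EFinP. Qed.

(** By Tonelli, the double integral of the absolute value is the product of two finite integrals. *)
Let integrable_prod : (m1 \x m2).-integrable setT fg.
Proof.
apply/integrable12ltyP => //.
have mabs (F : T -> R) : measurable_fun setT F ->
    measurable_fun setT (fun y => `|F y|%:E).
  by move=> mF; apply/measurable_EFinP; exact: measurableT_comp.
under eq_integral => y _.
  under eq_integral do rewrite /fg/= normrM EFinM.
  rewrite ge0_integralZl//; last exact: mabs.
  over.
rewrite ge0_integralZr//; [|exact: mabs|exact: integral_ge0].
apply: lte_mul_pinfty.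
- exact: integral_ge0.
- by rewrite ge0_fin_numE ?integral_ge0//; case/integrableP : im1.
- by case/integrableP : im2.
Qed.

Lemma independent_integrableM :
  P.-integrable setT (EFin \o (fun w => f (X w) * g (X' w))%R).
Proof.
have [_ ifg] := integrableP _ _ _ integrable_prod.
apply/integrableP; split.
  exact: (measurableT_comp mfg mZ).
rewrite (eq_measure_integral (distribution P Z)) in ifg; last first.
  by move=> A mA _; exact: distribution_pair.
by rewrite ge0_integral_distribution// in ifg; exact: measurableT_comp.
Qed.

Lemma independent_expectationM :
  \int[P]_w (f (X w) * g (X' w))%:E =
  \int[P]_w (f (X w))%:E * \int[P]_w (g (X' w))%:E.
Proof.
transitivity (\int[distribution P Z]_u fg u).
  by rewrite integral_distribution//; exact: independent_integrableM.
rewrite (eq_measure_integral (m1 \x m2)); last first.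
  by move=> A mA _; exact/esym/distribution_pair.
rewrite -integral12_prod_meas1//.
transitivity (\int[m1]_y ((f y)%:E * \int[m2]_z (g z)%:E)).
  by apply: eq_integral => y _; rewrite -integralZl.
rewrite -[X in _ = X * _](@integral_distribution _ _ _ _ _ P X (EFin \o f))//;
  last exact/measurable_EFinP.
rewrite -[X in _ = _ * X](@integral_distribution _ _ _ _ _ P X' (EFin \o g))//;
  last exact/measurable_EFinP.
rewrite -/m1 -/m2 -[X in _ = _ * X]fineK; last exact: integrable_fin_num.
by rewrite -integralZr//; apply: eq_integral => y _; rewrite fineK//; exact: integrable_fin_num.
Qed.

End independence.

(** * Covariance of two sample means *)

Section sample_covariance.
Context {R : realType} {dO : measure_display} {Omega : measurableType dO}
  (P : probability Omega R).

(** Integrability is bundled with the value because the real-valued integral of a non-integrable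
    function carries no information. *)
Definition has_expectation (X : Omega -> R) (e : R) : Prop :=
  P.-integrable setT (EFin \o X) /\ \int[P]_w X w = e.

Lemma has_expectationZ c X e :
  has_expectation X e -> has_expectation (fun w => c * X w) (c * e).
Proof.
move=> [iX <-]; split; last by rewrite RintegralZl.
exact: (integrableZl measurableT c iX).
Qed.

Lemma has_expectation_sum (I : Type) (s : seq I) (X : I -> Omega -> R)
    (e : I -> R) : (forall i, has_expectation (X i) (e i)) ->
  has_expectation (fun w => \sum_(i <- s) X i w) (\sum_(i <- s) e i).
Proof.
move=> Xe; have iX i := (Xe i).1; split.
  rewrite (_ : EFin \o _ = fun w => (\sum_(i <- s) (X i w)%:E)%E); last first.
    by apply/funext => w /=; rewrite sumEFin.
  by apply: integrable_sum => // i _; exact: iX.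
by rewrite Rintegral_sum//; apply: eq_bigr => i _; exact: (Xe i).2.
Qed.

Lemma covariance_has_expectation X X' e e' exx' :
  has_expectation X e -> has_expectation X' e' ->
  has_expectation (fun w => X w * X' w) exx' ->
  fine (covariance P X X') = exx' - e * e'.
Proof.
move=> [iX <-] [iX' <-] [iXX' <-].
have fn Z : P.-integrable setT (EFin \o Z) -> ('E_P[Z])%E = (\int[P]_w Z w)%:E.
  by move=> iZ; rewrite unlock /Rintegral fineK//; exact: integrable_fin_num.
rewrite covarianceE; [|exact/Lfun1_integrable..].
by rewrite !fn.
Qed.

Context {dY : measure_display} {Y : measurableType dY} (N : nat).
Variable (Ys : 'I_N -> Omega -> Y).
Hypothesis mYs : forall i, measurable_fun setT (Ys i).
Hypothesis iYs : mutually_independent P Ys.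

Lemma mutually_independent_pair i j A B : i != j ->
  measurable A -> measurable B ->
  P (Ys i @^-1` A `&` Ys j @^-1` B) = (P (Ys i @^-1` A) * P (Ys j @^-1` B))%E.
Proof.
move=> ij mA mB.
(* The whole space at every other index contributes a factor 1 to the product. *)
pose C k := if k == i then A else if k == j then B else setT.
have mC k : measurable (C k) by rewrite /C; case: ifP => // _; case: ifP.
have ji : j != i by rewrite eq_sym.
have := iYs mC.
rewrite (_ : \bigcap_k _ = Ys i @^-1` A `&` Ys j @^-1` B); last first.
  apply/seteqP; split=> w.
    move=> hw; have := hw i I; have := hw j I.
    by rewrite /C /= !eqxx (negbTE ji).
  move=> [hA hB] k _; rewrite /C /=.
  by case: eqP => [->//|_]; case: eqP => [->|].
move=> ->; rewrite (bigD1 i)//= (bigD1 j)//= big1 ?mule1.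
  by rewrite /C !eqxx (negbTE ji).
move=> k /andP[ki kj].
by rewrite /C (negbTE ki) (negbTE kj) preimage_setT probability_setT.
Qed.

Lemma covariance_sample_mean (f g : Y -> R) (ef eg efg : R) :
  (0 < N)%N -> measurable_fun setT f -> measurable_fun setT g ->
  (forall i, has_expectation (f \o Ys i) ef) ->
  (forall i, has_expectation (g \o Ys i) eg) ->
  (forall i, has_expectation (fun w => f (Ys i w) * g (Ys i w)) efg) ->
  fine (covariance P (fun w => N%:R^-1 * \sum_i f (Ys i w))
                     (fun w => N%:R^-1 * \sum_i g (Ys i w)))
  = N%:R^-1 * (efg - ef * eg).
Proof.
move=> N0 mf mg fE gE fgE.
have N0' : N%:R != 0 :> R by rewrite pnatr_eq0 -lt0n.
have meanE u e : (forall i, has_expectation (u \o Ys i) e) ->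
    has_expectation (fun w => N%:R^-1 * \sum_i u (Ys i w)) e.
  move=> uE.
  have -> : e = N%:R^-1 * \sum_(i < N) e.
    by rewrite sumr_const card_ord -[e *+ N]mulr_natl mulKf.
  by apply: has_expectationZ; exact: (has_expectation_sum _ uE).
(* Expectation of the cross term for samples [u.1] and [u.2]: the joint moment on the diagonal, the
   product of means elsewhere by independence. *)
pose ee (u : 'I_N * 'I_N) := if u.1 == u.2 then efg else ef * eg.
have prodE : has_expectation (fun w => (N%:R^-1 * \sum_i f (Ys i w)) *
    (N%:R^-1 * \sum_i g (Ys i w))) ((N%:R^-1 * N%:R^-1) * \sum_u ee u).
  rewrite (_ : (fun w => _) = (fun w => (N%:R^-1 * N%:R^-1) *
      \sum_(u : 'I_N * 'I_N) f (Ys u.1 w) * g (Ys u.2 w))); last first.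
    by apply/funext => w; rewrite mulrACA big_distrlr/= pair_bigA.
  apply: has_expectationZ.
  apply: (has_expectation_sum _ (X := fun (u : 'I_N * 'I_N) w =>
    f (Ys u.1 w) * g (Ys u.2 w))) => -[i j]; rewrite /ee/=.
  case: eqVneq => [<-//|ij].
  pose X k : {mfun Omega >-> Y} :=
    HB.pack (Ys k) (isMeasurableFun.Build _ _ _ _ (Ys k) (mYs k)).
  have ind A B : measurable A -> measurable B ->
    P (X i @^-1` A `&` X j @^-1` B) = (P (X i @^-1` A) * P (X j @^-1` B))%E.
    exact: mutually_independent_pair.
  have [[iF eF] [iG eG]] := (fE i, gE j).
  split; first exact: (independent_integrableM ind).
  rewrite /Rintegral (independent_expectationM ind)// fineM.
  - by rewrite -eF -eG.
  - exact: integrable_fin_num iF.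
  - exact: integrable_fin_num iG.
rewrite (covariance_has_expectation (meanE _ _ fE) (meanE _ _ gE) prodE).
(* Each of the [N] rows has one diagonal entry, hence exceeds [N%:R * (ef * eg)] by
   [efg - ef * eg]. *)
have -> : \sum_u ee u = N%:R * (N%:R * (ef * eg) + (efg - ef * eg)).
  rewrite /ee -(pair_bigA _ (fun i j => if i == j then efg else ef * eg))/=.
  transitivity (\sum_(i < N) (N%:R * (ef * eg) + (efg - ef * eg))); last first.
    by rewrite sumr_const card_ord [X in _ = X]mulr_natl.
  apply: eq_bigr => i _; rewrite (bigD1 i)//= eqxx.
  have -> : N%:R * (ef * eg) = ef * eg + \sum_(j < N | j != i) ef * eg.
    transitivity (\sum_(j < N) ef * eg); last by rewrite (bigD1 i).
    by rewrite sumr_const card_ord mulr_natl.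
  rewrite (eq_bigr (fun=> ef * eg)) => [|j]; last by rewrite eq_sym => /negbTE ->.
  ring.
by field.
Qed.

End sample_covariance.

(** * Covariance of the Fisher information estimator *)

Section exponential_family_sampling.
Context {R : realType} {dY : measure_display} {Y : measurableType dY}.
Variables (nu : {measure set Y -> \bar R}) (m : nat) (t : Y -> 'cV[R]_m).
Variable (h : 'cV[R]_m).
Hypothesis mt : forall a, measurable_fun setT (fun y => t y a 0).
Hypothesis hint : interior (natparam nu t) h.
Context {dO : measure_display} {Omega : measurableType dO}
  (P : probability Omega R).
Variable X : Omega -> Y.
Hypothesis mX : measurable_fun setT X.
Hypothesis XE : forall A, measurable A ->
  P (X @^-1` A) = (\int[nu]_(y in A) (efdens nu t h y)%:E)%E.

(** If it vanished, the density would integrate to 0, whereas the law of [X] has total mass 1. *)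
Lemma partition_function_gt0 : 0 < partition_function nu t h.
Proof.
have Zge0 : 0 <= partition_function nu t h.
  by apply: Rintegral_ge0 => y _; exact: expR_ge0.
rewrite lt_neqAle Zge0 andbT; apply/eqP => Z0.
have iu := natparam_integrable mt (interior_subset hint).
have int0 : (\int[nu]_y (unnorm_dens t h y)%:E = 0)%E.
  by rewrite -[LHS]fineK ?integrable_fin_num//; congr _%:E.
have := XE measurableT; rewrite preimage_setT probability_setT.
under eq_integral do rewrite /efdens expRD mulrC EFinM.
rewrite ge0_integralZl//; last first.
  by apply/measurable_EFinP; exact: measurable_unnorm_dens.
by rewrite int0 mule0 => /eqP; rewrite eqe oner_eq0.
Qed.

(** Transfers moments from [nu] to [Omega]: change of density for the law of [X], then integration
    against a pushforward. *)
Lemma has_expectation_efexp f : poly_bounded t f ->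
  has_expectation P (f \o X) (efexp nu t h f).
Proof.
move=> pf; have Z0 := partition_function_gt0.
pose X' : {mfun Omega >-> Y} := HB.pack X (isMeasurableFun.Build _ _ _ _ X mX).
have md : measurable_fun setT (efdens nu t h).
  rewrite (_ : efdens _ _ _ = fun y => (partition_function nu t h)^-1 *
      unnorm_dens t h y); last by apply/funext => y; exact: efdensE.
  by apply: measurable_funM => //; exact: measurable_unnorm_dens.
have mf := pf.1.
have [id eqd] := @integral_density R dY Y (distribution P X') nu
  (efdens nu t h) md (fun y => expR_ge0 _) XE f mf (efdens_integrable mt hint Z0 pf).
have iX : P.-integrable setT ((EFin \o f) \o X').
  apply/integrableP; split.
    by apply: measurableT_comp => //; exact/measurable_EFinP.
  case/integrableP : id => _; rewrite ge0_integral_distribution//.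
  by apply: measurableT_comp => //; exact/measurable_EFinP.
split=> //.
rewrite /efexp /Rintegral -eqd integral_distribution//.
exact/measurable_EFinP.
Qed.

End exponential_family_sampling.

(** * Second and fourth moments of linear statistics *)

Section score_moments.
Context {R : realType} {dY : measure_display} {Y : measurableType dY}.
Variables (nu : {measure set Y -> \bar R}) (m : nat) (t : Y -> 'cV[R]_m).
Variable (h : 'cV[R]_m).
Hypothesis mt : forall a, measurable_fun setT (fun y => t y a 0).
Hypothesis hint : interior (natparam nu t) h.
Hypothesis Z0 : 0 < partition_function nu t h.

Let delta a y := t y a 0 - efmean nu t h a.

(** With [c] a column of the Jacobian this is a component of the score. *)
Definition linear_stat (c : 'I_m -> R) (y : Y) : R := \sum_a c a * delta a y.

Let poly_bounded_delta a : poly_bounded t (delta a).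
Proof.
by apply: poly_boundedB; [exact: poly_bounded_t|exact: poly_bounded_cst].
Qed.

Lemma poly_bounded_linear_stat c : poly_bounded t (linear_stat c).
Proof.
apply: poly_bounded_sum => a; apply: poly_boundedM => //.
exact: poly_bounded_cst.
Qed.

Lemma efexp_linear_stat2 c1 c2 :
  efexp nu t h (fun y => linear_stat c1 y * linear_stat c2 y) =
  \sum_(u : 'I_m * 'I_m) c1 u.1 * c2 u.2 * effisher nu t h u.1 u.2.
Proof.
rewrite -(@efexp_sum _ _ _ nu _ t h mt hint Z0 ('I_m * 'I_m)%type
  (fun u => c1 u.1 * c2 u.2) (fun u y => delta u.1 y * delta u.2 y)); last first.
  by move=> u; exact: poly_boundedM.
congr efexp; apply/funext => y.
rewrite /linear_stat big_distrlr/= pair_bigA/=.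
by apply: eq_bigr => u _; rewrite mulrACA.
Qed.

Lemma efexp_linear_stat4 c1 c2 c3 c4 :
  efexp nu t h (fun y => linear_stat c1 y * linear_stat c2 y *
                         (linear_stat c3 y * linear_stat c4 y)) =
  \sum_(u : ('I_m * 'I_m) * ('I_m * 'I_m))
    c1 u.1.1 * c2 u.1.2 * c3 u.2.1 * c4 u.2.2 *
    efK nu t h u.1.1 u.1.2 u.2.1 u.2.2.
Proof.
rewrite -(@efexp_sum _ _ _ nu _ t h mt hint Z0 (('I_m * 'I_m) * ('I_m * 'I_m))%type
  (fun u => c1 u.1.1 * c2 u.1.2 * c3 u.2.1 * c4 u.2.2)
  (fun u y => delta u.1.1 y * delta u.1.2 y * delta u.2.1 y * delta u.2.2 y));
  last by move=> u; do 3![apply: poly_boundedM => //].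
congr efexp; apply/funext => y.
rewrite /linear_stat [X in X * (_ * _)]big_distrlr [X in _ * X]big_distrlr/=.
rewrite !pair_bigA/= big_distrlr/= pair_bigA/=.
by apply: eq_bigr => u _; ring.
Qed.

(** By multilinearity the fourth moment contributes [efK] and the product of second moments
    contributes the two [effisher] factors, with the same coefficients. *)
Lemma efcov_linear_stat c1 c2 c3 c4 :
  efexp nu t h (fun y => linear_stat c1 y * linear_stat c2 y *
                         (linear_stat c3 y * linear_stat c4 y))
  - efexp nu t h (fun y => linear_stat c1 y * linear_stat c2 y)
    * efexp nu t h (fun y => linear_stat c3 y * linear_stat c4 y)
  = \sum_a \sum_b \sum_c \sum_d c1 a * c2 b * c3 c * c4 d *
      (efK nu t h a b c d - effisher nu t h a b * effisher nu t h c d).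
Proof.
rewrite efexp_linear_stat4 !efexp_linear_stat2 big_distrlr/= pair_bigA/= sum4_pairs.
by rewrite -sumrB; apply: eq_bigr => u _; ring.
Qed.

End score_moments.

Theorem mainTheorem6 (R : realType) (L : nat) (n : nat -> nat)
    (x : 'cV[R]_(n 0)) (sigma : R -> R) (theta : pidx L n -> R)
    (dY : measure_display) (Y : measurableType dY)
    (nu : {measure set Y -> \bar R}) (t : Y -> 'cV[R]_(n L))
    (N : nat) (dO : measure_display) (Omega : measurableType dO)
    (P : probability Omega R) (Ys : 'I_N -> Omega -> Y) :
  (0 < L)%N ->
  (forall l, (l <= L)%N -> (0 < n l)%N) ->
  (0 < N)%N ->
  (forall z : R, derivable sigma z 1) ->
  (forall a : 'I_(n L), measurable_fun setT (fun y => t y a 0)) ->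
  interior (natparam nu t) (hL x sigma theta) ->
  (forall i, measurable_fun setT (Ys i)) ->
  (forall i (A : set Y), measurable A ->
     P (Ys i @^-1` A) = (\int[nu]_(y in A) (efdens nu t (hL x sigma theta) y)%:E)%E) ->
  mutually_independent P Ys ->
  let h := hL x sigma theta in
  let J := jacL x sigma theta in
  let CovI := fun p q r s : pidx L n =>
    fine (covariance P (Ihat1 x sigma nu t theta Ys p q)
                       (Ihat1 x sigma nu t theta Ys r s)) in
  Num.sqrt (\sum_(p : pidx L n) \sum_(q : pidx L n) \sum_(r : pidx L n)
              \sum_(s : pidx L n) CovI p q r s ^+ 2)
  <= N%:R^-1
     * Num.sqrt (\sum_(a < n L) \sum_(p : pidx L n) J a p ^+ 2) ^+ 4
     * Num.sqrt (\sum_(a < n L) \sum_(b < n L) \sum_(c < n L) \sum_(d < n L)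
          (efK nu t h a b c d - effisher nu t h a b * effisher nu t h c d) ^+ 2).
Proof.
move=> _ _ N0 dsigma mt hint mYs YsE iYs; cbv zeta.
set h := hL x sigma theta; set J := jacL x sigma theta.
have Z0 : 0 < partition_function nu t h.
  (* [0 < N] supplies a sample, whose law forces positivity. *)
  exact: (partition_function_gt0 mt hint (YsE (Ordinal N0))).
pose M a b c d := efK nu t h a b c d - effisher nu t h a b * effisher nu t h c d.
pose S p := linear_stat nu t h (J ^~ p).
have pS p : poly_bounded t (S p) by exact: poly_bounded_linear_stat.
have scoreS p y : score x sigma nu t theta p y = S p y by exact: scoreE.
have pSS p q : poly_bounded t (fun y => S p y * S q y) by exact: poly_boundedM.
have CovE p q r s : fine (covariance P (Ihat1 x sigma nu t theta Ys p q)
    (Ihat1 x sigma nu t theta Ys r s)) = N%:R^-1 * \sum_a \sum_b \sum_c \sum_d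
    J a p * J b q * J c r * J d s * M a b c d.
  rewrite -(efcov_linear_stat mt hint Z0).
  have IhatE p' q' : Ihat1 x sigma nu t theta Ys p' q' =
      fun w => N%:R^-1 * \sum_i (fun y => S p' y * S q' y) (Ys i w).
    apply/funext => w; congr (_ * _); apply: eq_bigr => i _.
    by rewrite !scoreS.
  rewrite !IhatE; apply: (covariance_sample_mean mYs iYs
    (f := fun y => S p y * S q y) (g := fun y => S r y * S s y)) => //.
  - exact: (pSS p q).1.
  - exact: (pSS r s).1.
  - by move=> i; apply: has_expectation_efexp => //; exact: YsE.
  - by move=> i; apply: has_expectation_efexp => //; exact: YsE.
  move=> i; apply: (@has_expectation_efexp _ _ _ nu _ t h mt hint _ _ _ (Ys i)
    _ _ (fun y => S p y * S q y * (S r y * S s y))) => //; first exact: YsE.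
  exact: poly_boundedM.
have SJ0 : 0 <= \sum_a \sum_p J a p ^+ 2.
  by apply: sumr_ge0 => a _; apply: sumr_ge0 => p _; exact: sqr_ge0.
have SM0 : 0 <= \sum_a \sum_b \sum_c \sum_d M a b c d ^+ 2.
  by do 4![apply: sumr_ge0 => ? _]; exact: sqr_ge0.
(* The right side is nonnegative, so it equals the root of its square and the radicands can be
   compared. *)
rewrite -[leRHS]ger0_norm; last by rewrite !mulr_ge0 ?exprn_ge0 ?sqrtr_ge0.
rewrite -sqrtr_sqr; apply: ler_wsqrtr.
rewrite 2!exprMn -exprM mulnC exprM !sqr_sqrtr// -mulrA.
apply: le_trans (ler_wpM2l (sqr_ge0 _) (sqr_tensor_contraction_le J M)).
rewrite mulr_sumr; apply: ler_sum => p _; rewrite mulr_sumr; apply: ler_sum => q _.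
rewrite mulr_sumr; apply: ler_sum => r _; rewrite mulr_sumr; apply: ler_sum => s _.
by rewrite CovE exprMn.
Qed.
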